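(* The functor $\mathrm{SA}\colon\mathbf{EG}\to\mathbf{ISA}$, sending an étale groupoid $G$ to its slice action $(\mathrm{Bis}\,G,G^{(0)},\gamma^G)$ and a couple morphism $[\varphi,\psi]$ to $\big(\psi\circ\varphi^{-1},\varphi^{(0)}\circ(\psi^{(0)})^{-1}\big)$, descends to a functor from the subcategory $\mathbf{EG_{lcH}}$ to the subcategory $\mathbf{ISA_{lcH}}$.
   Context: $\mathbf{ISA}$ and $\mathbf{ISA_{lcH}}$. A partial map $f\colon X\supset D_f\to Y$ is a continuous map from an open subspace $D_f\subset X$ to $Y$; $f^{-1}(V):=\{x\in D_f:f(x)\in V\}$; $f_2\circ f_1$ has domain $f_1^{-1}(D_{f_2})$; $f$ is proper if $f^{-1}(C)$ is compact for every compact $C\subset Y$. An inverse semigroup is a semigroup $S$ in which every $s$ has a unique $s^*$ with $ss^*s=s$, $s^*ss^*=s^*$. $I(X)$ is the inverse semigroup of homeomorphisms between open subspaces of $X$. An inverse semigroup action $(S,X,\alpha)$ is an inverse semigroup $S$, a topological space $X$ and a semigroup homomorphism $\alpha\colon S\to I(X)$ with $\bigcup_sD^\alpha_s=X$, $D^\alpha_s$ being the domain of $\alpha_s$. An action morphism $(\theta,\xi)\colon(S,X,\alpha)\to(T,Y,\beta)$ is a semigroup homomorphism $\theta\colon S\to T$ and a partial map $\xi\colon Y\supset D_\xi\to X$ with (i) $\xi^{-1}(D^\alpha_s)=D^\beta_{\theta(s)}$ for all $s\in S$; (ii) $\alpha_s(\xi(y))=\xi(\beta_{\theta(s)}(y))$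 for all $s\in S$, $y\in\xi^{-1}(D^\alpha_s)$; it is proper if $\xi$ is. Composition: $(\theta_2,\xi_2)\cdot(\theta_1,\xi_1)=(\theta_2\circ\theta_1,\xi_1\circ\xi_2)$; identities $(\mathrm{id}_S,\mathrm{id}_X)$. $\mathbf{ISA}$: all actions and action morphisms. $\mathbf{ISA_{lcH}}$: actions on locally compact Hausdorff spaces and proper action morphisms. $\mathbf{EG}$ and $\mathbf{EG_{lcH}}$. A groupoid $G$ has unit space $G^{(0)}\subset G$, domain and range maps $d,r$; $g'g$ is defined iff $d(g')=r(g)$; $G_u:=d^{-1}(u)$. A topological groupoid is étale if $d\colon G\to G^{(0)}$ is a local homeomorphism. For a groupoid homomorphism $\varphi\colon G\to H$, $\varphi^{(0)}$ and $\varphi_u\colon G_u\to H_{\varphi(u)}$ are its restrictions; $\varphi$ is fibrewise bijective if all $\varphi_u$ are bijective. A couple morphism $(\varphi,\psi;K)\colon G\to H$ of étale groupoids consists of an étale groupoid $K$, a continuous fibrewise bijective homomorphism $\varphi\colon K\to G$ and a continuous homomorphism $\psi\colon K\to H$ with $\psi^{(0)}$ open and injective; it is proper if $\varphi^{(0)}$ is proper. Equivalence: a homeomorphic groupoid isomorphism $\iota\colon K_1\to K_2$ with $\varphi_2\circ\iota=\varphi_1$, $\psi_2\circ\iota=\psi_1$; $[\varphi,\psi;K]$ (or $[\varphi,\psi]$) is the class. Composition of $[\varphi_1,\psi_1;K_1]\colon G_1\to G_2$ and $[\varphi_2,\psi_2;K_2]\colon G_2\to G_3$ is $[\varphi_1\circ\widetilde{\varphi_2},\psi_2\circ\widetilde{\psi_1};K_1\times_{G_2}K_2]$,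 with $K_1\times_{G_2}K_2=\{(k_1,k_2):\psi_1(k_1)=\varphi_2(k_2)\}$ (component-wise structure, topology from the product), $\widetilde{\varphi_2}(k_1,k_2)=k_1$, $\widetilde{\psi_1}(k_1,k_2)=k_2$; identities $[\mathrm{id}_G,\mathrm{id}_G;G]$. $\mathbf{EG}$: étale groupoids and classes of couple morphisms. $\mathbf{EG_{lcH}}$: étale groupoids with locally compact Hausdorff unit spaces and proper couple morphisms. The functor $\mathrm{SA}$. A bisection of $G$ is a subset on which $d$ and $r$ are injective. $\mathrm{Bis}\,G$ is the inverse semigroup of open bisections of $G$ with product $UV=\{uv:u\in U,v\in V,d(u)=r(v)\}$. For $U\in\mathrm{Bis}\,G$, $\gamma^G_U:=r|_U\circ(d|_U)^{-1}\colon d(U)\to r(U)$. For a couple morphism $[\varphi,\psi;K]\colon G\to H$, $\psi\circ\varphi^{-1}$ is the map $\mathrm{Bis}\,G\to\mathrm{Bis}\,H$, $U\mapsto\psi(\varphi^{-1}(U))$, and $\varphi^{(0)}\circ(\psi^{(0)})^{-1}$ is the partial map $H^{(0)}\supset\psi^{(0)}(K^{(0)})\to G^{(0)}$. *)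

(* Defs.v *)
From HB Require Import structures.
From mathcomp Require Import all_boot.
From mathcomp Require Import all_classical.
From mathcomp Require Import topology.

Set Implicit Arguments.
Unset Strict Implicit.
Unset Printing Implicit Defensive.

Local Open Scope classical_set_scope.

Record category := Category {
  obj :> Type;
  hom : obj -> obj -> Type;
  idm : forall X, hom X X;
  comp : forall X Y Z, hom Y Z -> hom X Y -> hom X Z;
  compA : forall X Y Z W (h : hom Z W) (g : hom Y Z) (f : hom X Y),
    comp h (comp g f) = comp (comp h g) f;
  comp1m : forall X Y (f : hom X Y), comp (idm Y) f = f;
  compm1 : forall X Y (f : hom X Y), comp f (idm X) = f }.

Record functor (C D : category) := Functor {
  fobj :> C -> D;
  fmap : forall X Y, hom X Y -> hom (fobj X) (fobj Y);
  fmap1 : forall X, fmap (idm X) = idm (fobj X);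
  fmapM : forall X Y Z (g : hom Y Z) (f : hom X Y),
    fmap (comp g f) = comp (fmap g) (fmap f) }.

Definition functor_comp (C D E : category) (G : functor D E) (F : functor C D) :
  functor C E.
Proof.
apply: (@Functor C E (fun X => G (F X)) (fun X Y f => fmap G (fmap F f))).
- by move=> X; rewrite !fmap1.
- by move=> X Y Z g f; rewrite !fmapM.
Defined.

Record subcategory (C : category) := Subcategory {
  sub_obj : C -> Prop;
  sub_hom : forall X Y : C, hom X Y -> Prop;
  sub_idm : forall X, sub_obj X -> sub_hom (idm X);
  sub_comp : forall X Y Z (g : hom Y Z) (f : hom X Y),
    sub_obj X -> sub_obj Y -> sub_obj Z ->
    sub_hom g -> sub_hom f -> sub_hom (comp g f) }.

Section Subcategory.
Variables (C : category) (S : subcategory C).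

Lemma sig_inj (T : Type) (P : T -> Prop) (x y : {x | P x}) :
  proj1_sig x = proj1_sig y -> x = y.
Proof.
by case: x y => [x px] [y py] /= e; case: _ / e py => py; congr exist; exact: Prop_irrelevance.
Qed.

Definition subcat_hom (X Y : {X : C | sub_obj S X}) : Type :=
  {f : hom (proj1_sig X) (proj1_sig Y) | sub_hom S f}.

Definition subcat : category.
Proof.
apply: (@Category {X : C | sub_obj S X} subcat_hom
  (fun X => exist _ (idm (proj1_sig X)) (sub_idm (proj2_sig X)))
  (fun X Y Z g f => exist _ (comp (proj1_sig g) (proj1_sig f))
     (sub_comp (proj2_sig X) (proj2_sig Y) (proj2_sig Z)
        (proj2_sig g) (proj2_sig f)))).
- by move=> X Y Z W h g f; apply: sig_inj; exact: compA.
- by move=> X Y f; apply: sig_inj; exact: comp1m.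
- by move=> X Y f; apply: sig_inj; exact: compm1.
Defined.

Definition inclusion : functor subcat C.
Proof.
by apply: (@Functor subcat C (fun X => proj1_sig X) (fun X Y f => proj1_sig f)).
Defined.

End Subcategory.

Lemma openP (X : topologicalType) (A : set X) :
  open A <-> forall x, A x -> nbhs x A.
Proof. by rewrite openE. Qed.

Lemma continuous_nbhs (X Y : topologicalType) (f : X -> Y) :
  continuous f <-> forall x V, nbhs (f x) V -> nbhs x (f @^-1` V).
Proof. by []. Qed.

Definition to_set (T : Type) (A : set T) (x : T) (Ax : A x) : A :=
  exist _ x (mem_set Ax).

Lemma to_setP (T : Type) (A : set T) (x : A) : A (val x).
Proof. exact: set_valP. Qed.

Lemma nbhs_set_type (X : topologicalType) (A : set X) (x : A) (V : set A) :
  nbhs x V <-> exists2 W, nbhs (val x) W & forall y : A, W (val y) -> V y.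
Proof.
split.
  case=> _ [[W oW <-] Wx WV]; exists W => //; exact: open_nbhs_nbhs.
case=> W; rewrite nbhsE => -[W' [oW' W'x] W'W] WV.
by exists (val @^-1` W'); split => //; [exists W'|move=> y /W'W /WV].
Qed.

Lemma val_continuous (X : topologicalType) (A : set X) :
  continuous (val : A -> X).
Proof. by move=> x V Vx; apply/nbhs_set_type; exists V. Qed.

Lemma continuous_set_type (X Y : topologicalType) (A : set X) (f : Y -> A) :
  continuous (val \o f) -> continuous f.
Proof.
move=> /continuous_nbhs cf; apply/continuous_nbhs => y V /nbhs_set_type[W Wx WV].
by apply: filterS (cf y W Wx) => z; exact: WV.
Qed.

Definition open_map (X Y : topologicalType) (f : X -> Y) :=
  forall A, open A -> open (f @` A).

Lemma open_map_nbhs (X Y : topologicalType) (f : X -> Y) (x : X) (A : set X) :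
  open_map f -> nbhs x A -> nbhs (f x) (f @` A).
Proof.
move=> of_; rewrite nbhsE => -[B [oB Bx] BA].
apply: (@filterS _ _ _ (f @` B)); first exact: image_subset.
by apply: open_nbhs_nbhs; split; [exact: of_|exists x].
Qed.

Definition proper_map (X Y : topologicalType) (f : X -> Y) :=
  forall C, compact C -> compact (f @^-1` C).

Lemma compact_of_image (X Y : topologicalType) (f : X -> Y) (A : set X) :
  injective f -> open_map f -> compact (f @` A) -> compact A.
Proof.
move=> fi fo cA F FF FA.
have img B : F B -> (f @ F) (f @` B).
  move=> FB; rewrite -[_ _]/(F (f @^-1` (f @` B))).
  exact: filterS (@preimage_image _ _ f B) FB.
have [_ [[a Aa <-] clA]] := cA (f @ F) _ (img _ FA).
exists a; split=> // B V FB Va.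
have [_ [[b Bb <-] [v Vv /fi e]]] :=
  clA (f @` B) (f @` V) (img _ FB) (open_map_nbhs fo Va).
by exists b; split=> //; rewrite -e.
Qed.

Section PartialMaps.
Variables (X Y : Type).
Implicit Type f : X -> option Y.

Definition pdom f : set X := [set x | exists y, f x = Some y].

Definition ppreimage f (V : set Y) : set X :=
  [set x | exists2 y, f x = Some y & V y].

Definition prestrict (U : set X) (f : X -> Y) : X -> option Y :=
  fun x => if `[< U x >] then Some (f x) else None.

Definition pinjective f := forall x x' y, f x = Some y -> f x' = Some y -> x = x'.

(* the inverse of an injective partial map *)
Definition pinv f : Y -> option X := fun y =>
  match pselect (exists x, f x = Some y) with
  | left h => Some (projT1 (cid h))
  | right _ => None
  end.

Definition pcomp (Z : Type) (g : Y -> option Z) f : X -> option Z :=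
  fun x => obind g (f x).

Lemma pmap_ext f g : (forall x y, f x = Some y <-> g x = Some y) -> f = g.
Proof.
move=> fg; apply/funext => x; case E: (f x) => [y|].
  by apply/esym/fg.
by case E': (g x) => [y|//]; move/fg: E'; rewrite E.
Qed.

Lemma prestrictP U (f : X -> Y) x y :
  prestrict U f x = Some y <-> U x /\ f x = y.
Proof.
rewrite /prestrict; case: asboolP => h; split=> //.
- by case.
- by case=> _ ->.
- by case.
Qed.

Lemma pinvP f : pinjective f -> forall x y, pinv f y = Some x <-> f x = Some y.
Proof.
move=> fi x y; rewrite /pinv; case: pselect => [h|nh].
  case: cid => x' /= e; split=> [[<-]//|e']; congr Some; exact: fi e e'.
by split=> // e; case: nh; exists x.
Qed.

Lemma pcompP (Z : Type) (g : Y -> option Z) f x z :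
  pcomp g f x = Some z <-> exists2 y, f x = Some y & g y = Some z.
Proof.
rewrite /pcomp; case: (f x) => [y|] /=; last by split=> // -[].
by split=> [e|[_ [<-]]//]; exists y.
Qed.

End PartialMaps.

Lemma pinv_inj (X Y : Type) (f : X -> option Y) :
  pinjective f -> pinjective (pinv f).
Proof. by move=> fi y y' x /(pinvP fi) e /(pinvP fi); rewrite e => -[]. Qed.

Lemma pinvK (X Y : Type) (f : X -> option Y) :
  pinjective f -> pinv (pinv f) = f.
Proof.
move=> fi; apply: pmap_ext => x y.
by rewrite (pinvP (pinv_inj fi)) (pinvP fi).
Qed.

Lemma pcomp_inj (X Y Z : Type) (g : Y -> option Z) (f : X -> option Y) :
  pinjective f -> pinjective g -> pinjective (pcomp g f).
Proof.
move=> fi gi x x' z /pcompP[y fy gy] /pcompP[y' fy' gy'].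
by rewrite (gi _ _ _ gy' gy) in fy'; exact: fi fy fy'.
Qed.

Lemma pinv_comp (X Y Z : Type) (g : Y -> option Z) (f : X -> option Y) :
  pinjective f -> pinjective g ->
  pinv (pcomp g f) = pcomp (pinv f) (pinv g).
Proof.
move=> fi gi; apply: pmap_ext => z x.
rewrite (pinvP (pcomp_inj fi gi)) !pcompP.
by split=> -[y a b]; exists y; move: a b; rewrite !pinvP.
Qed.

Lemma pcompA (X Y Z W : Type) (h : Z -> option W) (g : Y -> option Z)
    (f : X -> option Y) : pcomp h (pcomp g f) = pcomp (pcomp h g) f.
Proof. by apply/funext => x; rewrite /pcomp; case: (f x). Qed.

(* Since the domain is open, continuity on it amounts to continuity at each of
   its points with respect to the neighbourhoods in [X]. *)
Definition partial_map (X Y : topologicalType) (f : X -> option Y) :=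
  open (pdom f) /\
  forall x y, f x = Some y -> forall V, nbhs y V -> nbhs x (ppreimage f V).

Definition partial_homeo (X Y : topologicalType) (f : X -> option Y) :=
  [/\ partial_map f, pinjective f & partial_map (pinv f)].

Definition proper_partial_map (X Y : topologicalType) (f : X -> option Y) :=
  forall C, compact C -> compact (ppreimage f C).

Definition local_homeo (X Y : topologicalType) (f : X -> Y) :=
  forall x, exists2 U, U x & partial_homeo (prestrict U f).

Lemma partial_map_total (X Y : topologicalType) (f : X -> Y) :
  continuous f -> partial_map (fun x => Some (f x)).
Proof.
move=> /continuous_nbhs cf; split.
  by rewrite (_ : pdom _ = setT) ?predeqE => [|x]; [exact: openT|split=> // _; exists (f x)].
move=> x _ [<-] V Vx; by apply: filterS (cf x V Vx) => z Vz; exists (f z).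
Qed.

Lemma partial_map_comp (X Y Z : topologicalType) (g : Y -> option Z) (f : X -> option Y) :
  partial_map g -> partial_map f -> partial_map (pcomp g f).
Proof.
move=> [og cg] [of_ cf]; split.
  apply/openP => x [z /pcompP[y fx gy]].
  have : nbhs y (pdom g) by apply: open_nbhs_nbhs; split=> //; exists z.
  move/(cf _ _ fx); apply: filterS => x' [y' fx' [z' gy']].
  by exists z'; apply/pcompP; exists y'.
move=> x z /pcompP[y fx gy] V Vz.
apply: filterS (cf _ _ fx _ (cg _ _ gy _ Vz)) => x' [y' fx' [z' gy' Vz']].
by exists z' => //; apply/pcompP; exists y'.
Qed.

Lemma partial_homeo_inv (X Y : topologicalType) (f : X -> option Y) :
  partial_homeo f -> partial_homeo (pinv f).
Proof. by case=> pf fi pi; split; rewrite ?pinvK//; exact: pinv_inj. Qed.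

Lemma partial_homeo_comp (X Y Z : topologicalType) (g : Y -> option Z) (f : X -> option Y) :
  partial_homeo g -> partial_homeo f -> partial_homeo (pcomp g f).
Proof.
move=> [pg gi pgi] [pf fi pfi]; split.
- exact: partial_map_comp.
- exact: pcomp_inj.
- by rewrite pinv_comp//; exact: partial_map_comp.
Qed.

Section LocalHomeo.
Variables (X Y : topologicalType).

Lemma partial_homeo_restrict (U : set X) (f : X -> Y) :
  open U -> continuous f -> open_map f -> set_inj U f ->
  partial_homeo (prestrict U f).
Proof.
move=> oU /continuous_nbhs cf of_ fi.
have pi : pinjective (prestrict U f).
  move=> x x' y /prestrictP[Ux <-] /prestrictP[Ux' e].
  by apply: fi; rewrite ?inE.
split=> //; split.
- suff -> : pdom (prestrict U f) = U by [].
  rewrite predeqE => x; split=> [[y /prestrictP[]//]|Ux].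
  by exists (f x); apply/prestrictP.
- move=> x y /prestrictP[Ux <-] V Vx.
  have Un : nbhs x U by exact: open_nbhs_nbhs.
  apply: filterS (filterI Un (cf x V Vx)) => z [Uz Vz].
  by exists (f z) => //; apply/prestrictP.
- suff -> : pdom (pinv (prestrict U f)) = f @` U by exact: of_.
  rewrite predeqE => y; split=> [[x /(pinvP pi)/prestrictP[Ux e]]|[x Ux <-]].
    by exists x.
  by exists x; apply/(pinvP pi)/prestrictP.
- move=> y x /(pinvP pi)/prestrictP[Ux <-] V Vx.
  have Un : nbhs x U by exact: open_nbhs_nbhs.
  apply: filterS (open_map_nbhs of_ (filterI Un Vx)) => _ [z [Uz Vz] <-].
  by exists z => //; apply/(pinvP pi)/prestrictP.
Qed.

Lemma local_homeo_continuous (f : X -> Y) : local_homeo f -> continuous f.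
Proof.
move=> lf x V Vx; have [U Ux [[_ cU] _ _]] := lf x.
have e : prestrict U f x = Some (f x) by apply/prestrictP.
by apply: filterS (cU _ _ e _ Vx) => z [_ /prestrictP[Uz <-]].
Qed.

Lemma local_homeo_open (f : X -> Y) : local_homeo f -> open_map f.
Proof.
move=> lf A oA; apply/openP => _ [x Ax <-]; have [U Ux [_ fi [_ cU]]] := lf x.
have e : pinv (prestrict U f) (f x) = Some x by apply/(pinvP fi)/prestrictP.
have An : nbhs x A by exact: open_nbhs_nbhs.
apply: filterS (cU _ _ e _ An) => y [z /(pinvP fi)/prestrictP[Uz <-]] Az.
by exists z.
Qed.

Lemma local_homeo_inj (f : X -> Y) : local_homeo f ->
  forall x, exists U, [/\ open U, U x & forall a b, U a -> U b -> f a = f b -> a = b].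
Proof.
move=> lf x; have [U Ux [[oU _] fi _]] := lf x; exists U; split=> //.
  suff <- : pdom (prestrict U f) = U by [].
  rewrite predeqE => z; split=> [[y /prestrictP[]//]|Uz].
  by exists (f z); apply/prestrictP.
by move=> a b Ua Ub e; apply: (fi a b (f b)); apply/prestrictP.
Qed.

Lemma local_homeoI (f : X -> Y) : continuous f -> open_map f ->
  (forall x, exists U, [/\ open U, U x & forall a b, U a -> U b -> f a = f b -> a = b]) ->
  local_homeo f.
Proof.
move=> cf of_ fi x; have [U [oU Ux Ui]] := fi x; exists U => //.
apply: partial_homeo_restrict => // a b; rewrite !inE; exact: Ui.
Qed.

End LocalHomeo.

Definition inverse_semigroup (S : semigroupType) :=
  forall s : S, exists! t : S, (s * t * s = s)%g /\ (t * s * t = t)%g.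

Record pHomeo (X : topologicalType) := PHomeo {
  phomeo_fun :> X -> option X;
  phomeoP : partial_homeo phomeo_fun }.

Lemma phomeo_inj (X : topologicalType) (f g : pHomeo X) :
  (f : X -> option X) = g -> f = g.
Proof.
case: f g => f pf [g pg] /= e; case: _ / e pg => pg.
by congr PHomeo; exact: Prop_irrelevance.
Qed.

HB.instance Definition _ (X : topologicalType) := gen_eqMixin (pHomeo X).
HB.instance Definition _ (X : topologicalType) := gen_choiceMixin (pHomeo X).

Definition phomeo_mul (X : topologicalType) (f g : pHomeo X) : pHomeo X :=
  PHomeo (partial_homeo_comp (phomeoP f) (phomeoP g)).

Lemma phomeo_mulA (X : topologicalType) : associative (@phomeo_mul X).
Proof. by move=> f g h; apply: phomeo_inj; exact: pcompA. Qed.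

HB.instance Definition _ (X : topologicalType) :=
  isSemigroup.Build (pHomeo X) (@phomeo_mulA X).

Record isaction := ISAction {
  act_sg : semigroupType;
  act_inverse : inverse_semigroup act_sg;
  act_space : topologicalType;
  act : act_sg -> pHomeo act_space;
  actM : {morph act : s t / (s * t)%g};
  act_cover : \bigcup_s pdom (act s) = setT }.

Record action_morphism (A B : isaction) := ActionMorphism {
  am_theta : act_sg A -> act_sg B;
  am_xi : act_space B -> option (act_space A);
  am_thetaM : {morph am_theta : s t / (s * t)%g};
  am_xi_partial : partial_map am_xi;
  am_dom : forall s, ppreimage am_xi (pdom (act s)) = pdom (act (am_theta s));
  am_equiv : forall s y, ppreimage am_xi (pdom (act s)) y ->
    pcomp (act s) am_xi y = pcomp am_xi (act (am_theta s)) y }.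

Lemma action_morphism_ext (A B : isaction) (f g : action_morphism A B) :
  am_theta f = am_theta g -> am_xi f = am_xi g -> f = g.
Proof.
case: f g => a b c d e h [a' b' c' d' e' h'] /= ea eb.
case: _ / ea c' e' h' => c' e'; case: _ / eb d' e' => d' e' h'.
by congr ActionMorphism; exact: Prop_irrelevance.
Qed.

Definition am_id (A : isaction) : action_morphism A A.
Proof.
apply: (@ActionMorphism A A id (fun x => Some x)) => //.
- exact: (@partial_map_total _ _ id (fun x => @cvg_id _ (nbhs x))).
- by move=> s; rewrite predeqE => x; split=> [[_ [<-]]//|xs]; exists x.
- by move=> s y _; rewrite /pcomp /=; case: (phomeo_fun _ y).
Defined.

Lemma ppreimage_comp (X Y Z : Type) (g : Y -> option Z) (f : X -> option Y) V :
  ppreimage (pcomp g f) V = ppreimage f (ppreimage g V).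
Proof.
rewrite predeqE => x; split.
  by case=> z /pcompP[y fy gy] Vz; exists y => //; exists z.
by case=> y fy [z gy Vz]; exists z => //; apply/pcompP; exists y.
Qed.

Definition am_comp (A B C : isaction)
  (g : action_morphism B C) (f : action_morphism A B) : action_morphism A C.
Proof.
apply: (@ActionMorphism A C (am_theta g \o am_theta f)
  (pcomp (am_xi f) (am_xi g))).
- by move=> s t /=; rewrite !am_thetaM.
- by apply: partial_map_comp; exact: am_xi_partial.
- by move=> s; rewrite ppreimage_comp !am_dom.
- move=> s z; rewrite ppreimage_comp => -[y gz ys].
  have zs : ppreimage (am_xi g) (pdom (act (am_theta f s))) z.
    by exists y => //; rewrite -am_dom.
  rewrite pcompA -[RHS]/((pcomp (pcomp (am_xi f) (am_xi g))
    (act (am_theta g (am_theta f s)))) z) -pcompA.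
  have := am_equiv zs; rewrite /pcomp gz /= => e.
  have := am_equiv ys; rewrite /pcomp /= => ->.
  by rewrite e; case: (phomeo_fun _ z).
Defined.

Definition ISA : category.
Proof.
apply: (@Category isaction action_morphism am_id am_comp).
- by move=> A B C D h g f; apply: action_morphism_ext => //=; rewrite pcompA.
- move=> A B f; apply: action_morphism_ext => //=.
- move=> A B f; apply: action_morphism_ext => //=.
  by apply/funext => x; rewrite /pcomp /=; case: (am_xi f x).
Defined.

Definition lcH (X : topologicalType) :=
  locally_compact [set: X] /\ hausdorff_space X.

Definition ISA_lcH : subcategory ISA.
Proof.
apply: (@Subcategory ISA (fun A => lcH (act_space A))
  (fun A B f => proper_partial_map (am_xi f))).
- move=> A _ C; rewrite (_ : ppreimage _ _ = C)// predeqE => x.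
  by split=> [[_ [<-]]//|Cx]; exists x.
- move=> A B C g f _ _ _ pg pf K cK.
  by rewrite [ppreimage _ _]ppreimage_comp; apply/pg/pf.
Defined.

(* The product [gmul g h] is only meaningful when [gd g = gr h]; the unit space
   is identified with the set of the [g] such that [gd g = g]. *)
Record groupoid := Groupoid {
  gcarrier :> topologicalType;
  gd : gcarrier -> gcarrier;
  gr : gcarrier -> gcarrier;
  gmul : gcarrier -> gcarrier -> gcarrier;
  ginv : gcarrier -> gcarrier;
  gdd : forall g, gd (gd g) = gd g;
  grd : forall g, gr (gd g) = gd g;
  gdr : forall g, gd (gr g) = gr g;
  grr : forall g, gr (gr g) = gr g;
  gdM : forall g h, gd g = gr h -> gd (gmul g h) = gd h;
  grM : forall g h, gd g = gr h -> gr (gmul g h) = gr g;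
  gmulA : forall g h k, gd g = gr h -> gd h = gr k ->
    gmul g (gmul h k) = gmul (gmul g h) k;
  gmulgd : forall g, gmul g (gd g) = g;
  gmulrg : forall g, gmul (gr g) g = g;
  gdV : forall g, gd (ginv g) = gr g;
  grV : forall g, gr (ginv g) = gd g;
  gmulgV : forall g, gmul g (ginv g) = gr g;
  gmulVg : forall g, gmul (ginv g) g = gd g;
  gmul_continuous : {within [set p : gcarrier * gcarrier | gd p.1 = gr p.2],
    continuous (fun p => gmul p.1 p.2)};
  ginv_continuous : continuous ginv }.

Definition units (G : groupoid) : set G := [set g | gd g = g].
Arguments units : clear implicits.

Definition gd0 (G : groupoid) (g : G) : units G := to_set (gdd g : units G (gd g)).
Definition gr0 (G : groupoid) (g : G) : units G := to_set (gdr g : units G (gr g)).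

Record etale_groupoid := EtaleGroupoid {
  etale_base :> groupoid;
  etaleP : local_homeo (@gd0 etale_base) }.

Record ghom (G H : groupoid) := GHom {
  ghom_fun :> G -> H;
  ghomP : forall g h, gd g = gr h ->
    gd (ghom_fun g) = gr (ghom_fun h) /\
    ghom_fun (gmul g h) = gmul (ghom_fun g) (ghom_fun h) }.

Section GroupoidTheory.
Variable G : groupoid.
Implicit Types g h k : G.

Lemma gmulKV g h : gd g = gr h -> gmul (gmul g h) (ginv h) = g.
Proof. by move=> e; rewrite -gmulA ?grV// gmulgV -e gmulgd. Qed.

Lemma gmulVK g h : gd g = gd h -> gmul (gmul g (ginv h)) h = g.
Proof. by move=> e; rewrite -gmulA ?grV ?gdV// gmulVg -e gmulgd. Qed.

Lemma gmulKg g h : gd g = gr h -> gmul (ginv g) (gmul g h) = h.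
Proof. by move=> e; rewrite gmulA ?gdV// gmulVg e gmulrg. Qed.

Lemma gmul_idem g : gd g = gr g -> gmul g g = g -> g = gd g.
Proof. by move=> e e2; rewrite -[LHS](gmulKg e) e2 gmulVg. Qed.

Lemma ginvK : involutive (@ginv G).
Proof.
move=> g; rewrite -[ginv (ginv g)]gmulgd gdV grV -gmulVg.
by rewrite gmulA ?gdV ?grV// gmulVg gdV gmulrg.
Qed.

Lemma ginv_uniq g h : gd h = gr g -> gd g = gr h ->
  gmul (gmul h g) h = h -> g = ginv h.
Proof.
move=> hg gh e; have e' : gmul g h = gd h.
  by rewrite -[LHS](@gmulKg h) ?grM// (gmulA hg gh) e gmulVg.
by rewrite -[LHS](gmulKV gh) e' -grV gmulrg.
Qed.

Lemma unit_r g : gd g = g -> gr g = g.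
Proof. by move=> e; rewrite -[in LHS]e grd. Qed.

Lemma gd0_val (u : units G) : gd0 (val u) = u.
Proof. by apply: val_inj => /=; exact: (to_setP u). Qed.

Lemma gr0_val (u : units G) : gr0 (val u) = u.
Proof. by apply: val_inj => /=; rewrite unit_r //; exact: (to_setP u). Qed.

Lemma gr0E g : gr0 g = gd0 (ginv g).
Proof. by apply: val_inj; rewrite /= gdV. Qed.

Lemma gmul_nbhs g h W : gd g = gr h -> nbhs (gmul g h) W ->
  exists A B, [/\ nbhs g A, nbhs h B &
    forall a b, A a -> B b -> gd a = gr b -> W (gmul a b)].
Proof.
move=> e Wn; have /subspace_continuousP/(_ (g, h) e W Wn) := @gmul_continuous G.
rewrite /fmap /= /within /= => -[[A B] /= [An Bn] AB].
by exists A, B; split=> // a b Aa Bb ab; apply: (AB (a, b)).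
Qed.

End GroupoidTheory.

Section GHomTheory.
Variables (G H : groupoid) (f : ghom G H).
Implicit Types g h : G.

Lemma ghomM g h : gd g = gr h -> f (gmul g h) = gmul (f g) (f h).
Proof. by move=> /(ghomP f)[]. Qed.

Lemma ghom_unit g : gd g = g -> gd (f g) = f g.
Proof.
move=> e; have e' : gd g = gr g by rewrite e unit_r.
have [e1 e2] := ghomP f e'; apply/esym/gmul_idem => //.
by rewrite -e2 -{2}e gmulgd.
Qed.

Lemma ghomd g : f (gd g) = gd (f g).
Proof.
have e : gd g = gr (gd g) by rewrite grd.
have [-> _] := ghomP f e; rewrite unit_r //; by apply: ghom_unit; rewrite gdd.
Qed.

Lemma ghomr g : f (gr g) = gr (f g).
Proof.
have e : gd (gr g) = gr g by rewrite gdr.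
by have [<- _] := ghomP f e; rewrite ghom_unit.
Qed.

Lemma ghomV g : f (ginv g) = ginv (f g).
Proof.
have e : gd g = gr (ginv g) by rewrite grV.
have e' : gd (f g) = gr (f (ginv g)) by rewrite -ghomd -ghomr grV.
by rewrite -[LHS](gmulKg e') -ghomM// gmulgV ghomr -gdV gmulgd.
Qed.

Definition ghom0 (u : units G) : units H := to_set (ghom_unit (to_setP u)).

Lemma ghom0d g : ghom0 (gd0 g) = gd0 (f g).
Proof. by apply: val_inj; rewrite /= ghomd. Qed.

Lemma ghom0r g : ghom0 (gr0 g) = gr0 (f g).
Proof. by apply: val_inj; rewrite /= ghomr. Qed.

Lemma ghom0_continuous : continuous f -> continuous ghom0.
Proof.
move=> cf; apply: continuous_set_type => u.
apply: (@continuous_comp _ _ _ (val : units G -> G) f); last exact: cf.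
exact: val_continuous.
Qed.

Definition fibrewise_bijective := forall u : units G,
  set_bij [set g | gd0 g = u] [set h | gd0 h = ghom0 u] f.

Lemma fibre_inj : fibrewise_bijective ->
  forall g h, gd g = gd h -> f g = f h -> g = h.
Proof.
move=> fb g h e ef; have [_ inj _] := fb (gd0 h).
by apply: inj => //; rewrite inE /=; apply: val_inj.
Qed.

Lemma fibre_surj : fibrewise_bijective ->
  forall (u : G) (h : H), gd u = u -> gd h = f u -> exists2 g, gd g = u & f g = h.
Proof.
move=> fb u h e eh; have [_ _ surj] := fb (gd0 u).
have [|g /= gu gh] := surj h; first by apply: val_inj; rewrite /= e.
by exists g => //; rewrite -e; exact: (congr1 val gu).
Qed.

Lemma fibrewise_bijectiveI :
  (forall g h, gd g = gd h -> f g = f h -> g = h) ->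
  (forall (u : G) (h : H), gd u = u -> gd h = f u -> exists2 g, gd g = u & f g = h) ->
  fibrewise_bijective.
Proof.
move=> inj surj u; split.
- by move=> g /= <-; rewrite ghom0d.
- move=> g h; rewrite !inE /= => gu hu; apply: inj.
  by rewrite -[LHS]/(val (gd0 g)) gu -hu.
- move=> h /= hu; have [|g gu gh] := surj (val u) h (to_setP u).
    by rewrite -[LHS]/(val (gd0 h)) hu.
  by exists g => //=; apply: val_inj.
Qed.

End GHomTheory.

Definition ghom_id (G : groupoid) : ghom G G.
Proof. by exists id. Defined.

Definition ghom_comp (G H K : groupoid) (g : ghom H K) (f : ghom G H) : ghom G K.
Proof.
exists (g \o f) => a b ab /=; have [e1 e2] := ghomP f ab.
by rewrite e2; exact: ghomP.
Defined.

Section EtaleTheory.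
Variable G : etale_groupoid.

Lemma gd0_continuous : continuous (@gd0 G).
Proof. exact/local_homeo_continuous/etaleP. Qed.

Lemma gd_continuous : continuous (@gd G).
Proof.
move=> g; apply: (@continuous_comp _ _ _ (@gd0 G) val).
  exact: gd0_continuous.
exact: val_continuous.
Qed.

Lemma gd0_open : open_map (@gd0 G).
Proof. exact/local_homeo_open/etaleP. Qed.

Lemma gd_inj (g : G) : exists U : set G, [/\ open U, U g &
  forall a b, U a -> U b -> gd a = gd b -> a = b].
Proof.
have [U [oU Ug inj]] := local_homeo_inj (@etaleP G) g; exists U; split=> // a b Ua Ub e.
by apply: inj => //; exact: val_inj.
Qed.

Lemma ginv_open : open_map (@ginv G).
Proof.
move=> A oA; suff -> : (@ginv G) @` A = (@ginv G) @^-1` A.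
  by apply: open_comp => // g _; exact: ginv_continuous.
rewrite predeqE => g; split=> [[h Ah <-]|Ag] /=; first by rewrite ginvK.
by exists (ginv g) => //; rewrite ginvK.
Qed.

Lemma gr0_continuous : continuous (@gr0 G).
Proof.
have -> : @gr0 G = @gd0 G \o @ginv G by apply/funext => g /=; rewrite gr0E.
move=> g; apply: continuous_comp; [exact: ginv_continuous|exact: gd0_continuous].
Qed.

Lemma gr0_open : open_map (@gr0 G).
Proof.
move=> A oA; rewrite (_ : _ @` A = @gd0 G @` (@ginv G @` A)).
  exact/gd0_open/ginv_open.
by rewrite image_comp; congr image; apply/funext => g; rewrite /= gr0E.
Qed.

End EtaleTheory.

Record bis (G : groupoid) := Bis {
  bis_set :> G -> Prop;
  bis_open : open bis_set;
  bis_dinj : set_inj bis_set (@gd G);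
  bis_rinj : set_inj bis_set (@gr G) }.

Lemma bis_ext (G : groupoid) (U V : bis G) : (U : set G) = V -> U = V.
Proof.
case: U V => U a b c [V a' b' c'] /= e; case: _ / e a' b' c' => a' b' c'.
by congr Bis; exact: Prop_irrelevance.
Qed.

HB.instance Definition _ (G : groupoid) := gen_eqMixin (bis G).
HB.instance Definition _ (G : groupoid) := gen_choiceMixin (bis G).

Section BisTheory.
Variable G : groupoid.
Implicit Types (U V : bis G) (g h : G).

Lemma bis_d U g h : U g -> U h -> gd g = gd h -> g = h.
Proof. by move=> Ug Uh; apply: (@bis_dinj _ U); rewrite inE. Qed.

Lemma bis_r U g h : U g -> U h -> gr g = gr h -> g = h.
Proof. by move=> Ug Uh; apply: (@bis_rinj _ U); rewrite inE. Qed.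

Definition set_gmul (U V : set G) : set G :=
  [set g | exists u v, [/\ U u, V v, gd u = gr v & g = gmul u v]].

Lemma set_gmulA (U V W : set G) :
  set_gmul U (set_gmul V W) = set_gmul (set_gmul U V) W.
Proof.
rewrite predeqE => g; split.
  move=> [u [_ [Uu [v [w [Vv Ww vw ->]]] + ->]]].
  rewrite grM // => uv; exists (gmul u v), w; split=> //.
  - by exists u, v.
  - by rewrite gdM.
  - by rewrite gmulA.
move=> [_ [w [[u [v [Uu Vv uv ->]]] Ww + ->]]].
rewrite gdM // => vw; exists u, (gmul v w); split=> //.
- by exists v, w.
- by rewrite grM.
- by rewrite -gmulA.
Qed.

End BisTheory.

Section Slice.
Variable G : etale_groupoid.
Implicit Types U V : bis G.

Lemma bis_mul_open U V : open (set_gmul U V).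
Proof.
apply/openP => _ [u [v [Uu Vv uv ->]]].
have e : gd (gmul u v) = gr (ginv v) by rewrite grV gdM.
have Un : nbhs (gmul (gmul u v) (ginv v)) U.
  by rewrite gmulKV//; apply: open_nbhs_nbhs; split=> //; exact: bis_open.
have [A [B [An Bn AB]]] := gmul_nbhs e Un.
have Vn : nbhs v V by apply: open_nbhs_nbhs; split=> //; exact: bis_open.
have On : nbhs v (V `&` @ginv G @^-1` B).
  exact: filterI Vn (ginv_continuous Bn).
have := open_map_nbhs (@gd0_open G) On.
have -> : gd0 v = gd0 (gmul u v) by apply: val_inj; rewrite /= gdM.
move=> /gd0_continuous On'.
apply: filterS (filterI An On') => g [Ag [v' [Vv' Bv'] /(congr1 val)/= vg]].
exists (gmul g (ginv v')), v'; split=> //.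
- by apply: AB => //; rewrite grV.
- by rewrite gdM ?gdV ?grV.
- by rewrite gmulVK.
Qed.

Lemma bis_mul_dinj U V : set_inj (set_gmul U V) (@gd G).
Proof.
move=> g h; rewrite !inE => -[u [v [Uu Vv uv ->]]] [u' [v' [Uu' Vv' uv' ->]]].
rewrite !gdM// => /(bis_d Vv Vv') ev; rewrite -ev in uv' *.
by rewrite (bis_d Uu Uu')// uv uv'.
Qed.

Lemma bis_mul_rinj U V : set_inj (set_gmul U V) (@gr G).
Proof.
move=> g h; rewrite !inE => -[u [v [Uu Vv uv ->]]] [u' [v' [Uu' Vv' uv' ->]]].
rewrite !grM// => /(bis_r Uu Uu') eu; rewrite -eu in uv' *.
by rewrite (bis_r Vv Vv')// -uv -uv'.
Qed.

Definition bis_mul U V : bis G :=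
  Bis (@bis_mul_open U V) (@bis_mul_dinj U V) (@bis_mul_rinj U V).

Lemma bis_mulA : associative bis_mul.
Proof. by move=> U V W; apply: bis_ext; exact: set_gmulA. Qed.

Definition bis_inv U : bis G.
Proof.
apply: (@Bis G (@ginv G @` U)).
- by apply: ginv_open; exact: bis_open.
- move=> g h; rewrite !inE => -[u Uu <-] [v Vv <-]; rewrite !gdV => e.
  by rewrite (bis_r Uu Vv e).
- move=> g h; rewrite !inE => -[u Uu <-] [v Vv <-]; rewrite !grV => e.
  by rewrite (bis_d Uu Vv e).
Defined.

Lemma unit_bis (u : units G) : exists U : bis G, U (val u) /\
  forall g, U g -> gd g = g.
Proof.
have [O [oO Ou inj]] := gd_inj (val u).
have Oid g : O g -> O (gd g) -> gd g = g by move=> ? ?; apply: inj => //; rewrite gdd.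
have oU : open (O `&` @gd G @^-1` O).
  by apply: openI => //; apply: open_comp => // g _; exact: gd_continuous.
unshelve eexists (@Bis G (O `&` @gd G @^-1` O) oU _ _).
- by move=> g h; rewrite !inE => -[/= /Oid a /a <-] [/= /Oid b /b <-]; rewrite !gdd.
- move=> g h; rewrite !inE => -[/= /Oid a /a {}a] [/= /Oid b /b {}b].
  by rewrite !unit_r.
- split=> [|g [/= Og /(Oid _ Og)]//]; split=> //=.
  by have -> := to_setP u : gd _ = _.
Qed.

End Slice.

HB.instance Definition _ (G : etale_groupoid) :=
  isSemigroup.Build (bis G) (@bis_mulA G).

Section SliceAction.
Variable G : etale_groupoid.
Implicit Types U V : bis G.

Lemma bis_mulE U V : ((U * V)%g : set G) = set_gmul U V.
Proof. by []. Qed.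

Lemma bis_mulVK U : (U * bis_inv U * U)%g = U.
Proof.
apply: bis_ext; rewrite !bis_mulE predeqE => g; split.
  move=> [_ [w [[u [_ [Uu [v Uv <-] + ->]]] Uw + ->]]].
  rewrite grV => /[dup] uv /(bis_d Uu Uv) <-.
  by rewrite gdM ?grV// gdV gmulgV => /(bis_r Uu Uw) <-; rewrite gmulrg.
move=> Ug; exists (gr g), g; split; rewrite ?gdr ?gmulrg//.
exists g, (ginv g); split; rewrite ?grV ?gmulgV//; by exists g.
Qed.

Lemma bis_invK U : bis_inv (bis_inv U) = U.
Proof.
apply: bis_ext; rewrite predeqE => g; split=> [[_ [h Uh <-] <-]|Ug] /=.
  by rewrite ginvK.
by exists (ginv g); [exists g|rewrite ginvK].
Qed.

Lemma bis_inverse_sub U V :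
  (V * U * V)%g = V -> (V : set G) `<=` bis_inv U.
Proof.
move=> VUV v Vv; have : (V * U * V)%g v by rewrite VUV.
move=> [_ [w [[v' [u [Vv' Uu vu ->]]] Vw + e]]]; rewrite gdM// => uw.
have ew : w = v by apply: (bis_d Vw Vv); rewrite e !gdM// gdM.
have ev' : v' = v by apply: (bis_r Vv' Vv); rewrite e !grM// gdM.
rewrite ew ev' in e uw vu.
by exists u => //; rewrite (ginv_uniq vu uw (esym e)) ginvK.
Qed.

Lemma bis_inverse : inverse_semigroup (bis G).
Proof.
move=> U; exists (bis_inv U); split.
  split; first exact: bis_mulVK.
  by have := bis_mulVK (bis_inv U); rewrite bis_invK.
move=> V [UVU VUV]; apply: bis_ext; rewrite eqEsubset; split.
  move=> _ [u Uu <-]; have [v Vv <-] := bis_inverse_sub UVU Uu.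
  by rewrite ginvK.
exact: bis_inverse_sub.
Qed.

Definition gamma U : units G -> option (units G) :=
  pcomp (prestrict U (@gr0 G)) (pinv (prestrict U (@gd0 G))).

Lemma gd0_bis U : partial_homeo (prestrict U (@gd0 G)).
Proof.
apply: partial_homeo_restrict (@bis_open _ U) (@gd0_continuous G) (@gd0_open G) _.
by move=> g h Ug Uh /(congr1 val)/=; exact: bis_dinj Ug Uh.
Qed.

Lemma gr0_bis U : partial_homeo (prestrict U (@gr0 G)).
Proof.
apply: partial_homeo_restrict (@bis_open _ U) (@gr0_continuous G) (@gr0_open G) _.
by move=> g h Ug Uh /(congr1 val)/=; exact: bis_rinj Ug Uh.
Qed.

Lemma gamma_homeo U : partial_homeo (gamma U).
Proof.
by apply: partial_homeo_comp; [exact: gr0_bis|exact/partial_homeo_inv/gd0_bis].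
Qed.

Lemma gammaP U x y :
  gamma U x = Some y <-> exists g, [/\ U g, gd0 g = x & gr0 g = y].
Proof.
have [_ inj _] := gd0_bis U; rewrite pcompP; split.
  by move=> [g /(pinvP inj)/prestrictP[Ug gx] /prestrictP[_ gy]]; exists g.
by move=> [g [Ug gx gy]]; exists g; [apply/(pinvP inj)|]; apply/prestrictP.
Qed.

Lemma gammaM U V : gamma (U * V)%g = pcomp (gamma U) (gamma V).
Proof.
apply: pmap_ext => x z; rewrite gammaP pcompP; split.
  move=> [_ [[u [v [Uu Vv uv ->]]] <- <-]]; exists (gr0 v); apply/gammaP.
    by exists v; split=> //; apply: val_inj; rewrite /= gdM.
  by exists u; split=> //; apply: val_inj; rewrite /= ?grM.
move=> [y /gammaP[v [Vv <- <-]] /gammaP[u [Uu /(congr1 val)/= uv <-]]].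
exists (gmul u v); split; first by exists u, v.
  by apply: val_inj; rewrite /= gdM.
by apply: val_inj; rewrite /= grM.
Qed.

Definition slice_act U : pHomeo (units G) := PHomeo (gamma_homeo U).

Lemma slice_actM : {morph slice_act : U V / (U * V)%g}.
Proof. by move=> U V; apply: phomeo_inj; exact: gammaM. Qed.

Lemma slice_cover : \bigcup_U pdom (slice_act U) = setT.
Proof.
rewrite predeqE => x; split=> // _; have [U [Ux _]] := unit_bis x.
by exists U => //; exists (gr0 (val x)); apply/gammaP; exists (val x); rewrite gd0_val.
Qed.

Definition slice_action : isaction := ISAction bis_inverse slice_actM slice_cover.

End SliceAction.

Record couple_morphism (G H : etale_groupoid) := CoupleMorphism {
  cm_mid : etale_groupoid;
  cm_phi : ghom cm_mid G;
  cm_psi : ghom cm_mid H;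
  cm_phi_continuous : continuous cm_phi;
  cm_psi_continuous : continuous cm_psi;
  cm_phi_bij : fibrewise_bijective cm_phi;
  cm_psi_open : open_map (ghom0 cm_psi);
  cm_psi_inj : injective (ghom0 cm_psi) }.

Definition couple_eq (G H : etale_groupoid) (c1 c2 : couple_morphism G H) :=
  exists (i : ghom (cm_mid c1) (cm_mid c2)) (j : ghom (cm_mid c2) (cm_mid c1)),
    [/\ continuous i /\ continuous j, cancel i j, cancel j i,
        forall k, cm_phi c2 (i k) = cm_phi c1 k &
        forall k, cm_psi c2 (i k) = cm_psi c1 k].

Lemma couple_eq_refl G H (c : couple_morphism G H) : couple_eq c c.
Proof.
exists (ghom_id _), (ghom_id _); split=> //.
by split=> k; exact: cvg_id.
Qed.

Lemma couple_eq_sym G H (c1 c2 : couple_morphism G H) :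
  couple_eq c1 c2 -> couple_eq c2 c1.
Proof.
move=> [i [j [[ci cj] ij ji ei ej]]]; exists j, i; split=> // k.
- by rewrite -ei ji.
- by rewrite -ej ji.
Qed.

Lemma couple_eq_trans G H (c2 c1 c3 : couple_morphism G H) :
  couple_eq c1 c2 -> couple_eq c2 c3 -> couple_eq c1 c3.
Proof.
move=> [i [j [[ci cj] ij ji ei ej]]] [i' [j' [[ci' cj'] ij' ji' ei' ej']]].
exists (ghom_comp i' i), (ghom_comp j j'); split.
- by split=> k; apply: continuous_comp; [exact: ci|exact: ci'|exact: cj'|exact: cj].
- by move=> k /=; rewrite ij' ij.
- by move=> k /=; rewrite ji ji'.
- by move=> k /=; rewrite ei' ei.
- by move=> k /=; rewrite ej' ej.
Qed.

Section CoupleTheory.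
Variables (G H : etale_groupoid) (c : couple_morphism G H).
Local Notation K := (cm_mid c).
Local Notation phi := (cm_phi c).
Local Notation psi := (cm_psi c).

Lemma psi_dinj (k l : K) : gd (psi k) = gd (psi l) -> gd k = gd l.
Proof.
move=> e; apply: (congr1 val (_ : gd0 k = gd0 l)).
by apply: (cm_psi_inj (c := c)); rewrite !ghom0d; exact: val_inj.
Qed.

Lemma psi_rinj (k l : K) : gr (psi k) = gr (psi l) -> gr k = gr l.
Proof.
by rewrite -!gdV -!ghomV => /psi_dinj; rewrite !gdV.
Qed.

Lemma psi_drinj (k l : K) : gd (psi k) = gr (psi l) -> gd k = gr l.
Proof. by rewrite -!gdV -!ghomV => /psi_dinj; rewrite !gdV. Qed.

Lemma psi_open : open_map psi.
Proof.
move=> A oA; apply/openP => _ [k Ak <-].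
have [V [oV Vk inj]] := gd_inj (psi k).
have Bn : nbhs k (A `&` psi @^-1` V).
  apply: filterI; first exact: open_nbhs_nbhs.
  by apply: cm_psi_continuous; exact: open_nbhs_nbhs.
have := open_map_nbhs (cm_psi_open (c := c)) (open_map_nbhs (@gd0_open K) Bn).
rewrite ghom0d => /gd0_continuous Wn.
apply: filterS (filterI (open_nbhs_nbhs (conj oV Vk)) Wn).
move=> h [Vh [_ [l [Al Vl] <-] e]]; exists l => //; apply: inj => //.
by move/(congr1 val): e; rewrite ghom0d.
Qed.

Lemma couple_bis_open (U : bis G) : open (psi @` (phi @^-1` U)).
Proof.
apply: psi_open; apply: open_comp; last exact: bis_open.
by move=> k _; exact: cm_phi_continuous.
Qed.

Lemma couple_bis_dinj (U : bis G) : set_inj (psi @` (phi @^-1` U)) (@gd H).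
Proof.
move=> g h; rewrite !inE => -[k /= Uk <-] [l /= Ul <-] /psi_dinj e.
suff -> : k = l by []; apply: (fibre_inj (@cm_phi_bij _ _ c)) => //.
by apply: (bis_d Uk Ul); rewrite -!ghomd e.
Qed.

Lemma couple_bis_rinj (U : bis G) : set_inj (psi @` (phi @^-1` U)) (@gr H).
Proof.
move=> g h; rewrite !inE => -[k /= Uk <-] [l /= Ul <-] /psi_rinj e.
suff -> : k = l by []; apply: (can_inj (@ginvK K)).
apply: (fibre_inj (@cm_phi_bij _ _ c)); first by rewrite !gdV.
by rewrite !ghomV; congr ginv; apply: (bis_r Uk Ul); rewrite -!ghomr e.
Qed.

(* psi o phi^-1 on bisections *)
Definition couple_bis (U : bis G) : bis H :=
  Bis (@couple_bis_open U) (@couple_bis_dinj U) (@couple_bis_rinj U).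

Lemma couple_bisM : {morph couple_bis : U V / (U * V)%g}.
Proof.
move=> U V; apply: bis_ext; rewrite predeqE => h; split.
  move=> [k /= [u [v [Uu Vv uv ek]]] <-].
  have ev : gd v = phi (gd k) by rewrite ghomd ek gdM.
  have [l lk lv] := fibre_surj (@cm_phi_bij _ _ c) (gdd k) ev.
  have kl : gd k = gr (ginv l) by rewrite grV.
  exists (psi (gmul k (ginv l))), (psi l); split.
  - by exists (gmul k (ginv l)) => //=; rewrite ghomM// ghomV ek lv gmulKV.
  - by exists l => //=; rewrite lv.
  - by rewrite -ghomd gdM// gdV ghomr.
  - by rewrite -ghomM ?gmulVK// gdM// gdV.
move=> [_ [_ [[k /= Uk <-] [l /= Vl <-] /psi_drinj kl ->]]].
exists (gmul k l); last by rewrite ghomM.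
exists (phi k), (phi l); split=> //; last by rewrite ghomM.
by rewrite -ghomd kl ghomr.
Qed.

(* phi^(0) o (psi^(0))^-1 *)
Definition couple_partial : units H -> option (units G) :=
  pcomp (fun u => Some (ghom0 phi u)) (pinv (fun u => Some (ghom0 psi u))).

Lemma psi0_pinj : pinjective (fun u => Some (ghom0 psi u)).
Proof. move=> u v y e e'; apply: (@cm_psi_inj _ _ c); apply: Some_inj.
by rewrite e e'. Qed.

Lemma couple_partialP y x : couple_partial y = Some x <->
  exists2 u, ghom0 psi u = y & ghom0 phi u = x.
Proof.
rewrite pcompP; split=> -[u].
  by move=> /(pinvP psi0_pinj)[<-] [<-]; exists u.
by move=> <- <-; exists u => //; apply/(pinvP psi0_pinj).
Qed.

Lemma couple_partial_partial : partial_map couple_partial.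
Proof.
apply: partial_map_comp.
  exact/partial_map_total/ghom0_continuous/cm_phi_continuous.
have := @partial_homeo_restrict _ _ setT (ghom0 psi) openT
  (ghom0_continuous (cm_psi_continuous (c := c))) (cm_psi_open (c := c))
  (fun x y _ _ => @cm_psi_inj _ _ c x y).
suff -> : prestrict setT (ghom0 psi) = fun u => Some (ghom0 psi u) by case.
by apply: pmap_ext => x y; rewrite prestrictP; split=> [[_ ->]|[->]].
Qed.

Lemma couple_gamma (U : bis G) k : (phi @^-1` U) k ->
  gamma U (ghom0 phi (gd0 k)) = Some (ghom0 phi (gr0 k)) /\
  gamma (couple_bis U) (ghom0 psi (gd0 k)) = Some (ghom0 psi (gr0 k)).
Proof.
move=> Uk; split; apply/gammaP.
  by exists (phi k); rewrite ghom0d ghom0r.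
by exists (psi k); rewrite ghom0d ghom0r; split=> //; exists k.
Qed.

Lemma couple_lift (U : bis G) u x : gamma U (ghom0 phi u) = Some x ->
  exists2 k, (phi @^-1` U) k & gd0 k = u.
Proof.
move=> /gammaP[g [Ug /(congr1 val)/= gu _]].
have [k ku kg] := fibre_surj (@cm_phi_bij _ _ c) (to_setP u : gd _ = _) gu.
by exists k; [rewrite /= kg|exact: val_inj].
Qed.

Definition couple_action : action_morphism (slice_action G) (slice_action H).
Proof.
apply: (@ActionMorphism (slice_action G) (slice_action H) couple_bis couple_partial).
- exact: couple_bisM.
- exact: couple_partial_partial.
- move=> U; rewrite predeqE => y; split.
    move=> [_ /couple_partialP[u <- <-] [x /couple_lift[k Uk <-]]].
    by exists (ghom0 psi (gr0 k)); have [] := couple_gamma Uk.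
  move=> [_ /gammaP[_ [[k Uk <-] <- _]]]; rewrite -ghom0d.
  exists (ghom0 phi (gd0 k)); first by apply/couple_partialP; exists (gd0 k).
  by exists (ghom0 phi (gr0 k)); have [] := couple_gamma Uk.
- move=> U y [x yx [z xz]]; rewrite /pcomp yx /=.
  move: (yx) xz => /couple_partialP[u <- <-] /couple_lift[k Uk <-].
  have [-> /= ->] := couple_gamma Uk; apply/esym/couple_partialP.
  by exists (gr0 k).
Defined.

End CoupleTheory.

Lemma couple_action_eq G H (c1 c2 : couple_morphism G H) :
  couple_eq c1 c2 -> couple_action c1 = couple_action c2.
Proof.
move=> [i [j [_ ij ji ei ej]]]; apply: action_morphism_ext.
  apply/funext => U; apply: bis_ext; rewrite predeqE => h /=; split.
    by move=> [k /= Uk <-]; exists (i k); rewrite /= ?ei ?ej.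
  by move=> [k /= Uk <-]; exists (j k); rewrite /= -?ei -?ej ji.
apply: pmap_ext => y x; rewrite !couple_partialP; split.
  by move=> [u <- <-]; exists (ghom0 i u); apply: val_inj; rewrite /= ?ei ?ej.
by move=> [u <- <-]; exists (ghom0 j u); apply: val_inj; rewrite /= -?ei -?ej ji.
Qed.

Lemma open_map_comp (X Y Z : topologicalType) (f : X -> Y) (g : Y -> Z) :
  open_map f -> open_map g -> open_map (g \o f).
Proof. by move=> of_ og A /of_/og; rewrite image_comp. Qed.

Section FibreProduct.
Variables (G K1 K2 : etale_groupoid) (f1 : ghom K1 G) (f2 : ghom K2 G).
Hypotheses (f1_cont : continuous f1) (f2_cont : continuous f2).

Definition fp_set : set (K1 * K2) := [set k | f1 k.1 = f2 k.2].
Implicit Types p q : fp_set.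

Lemma fpP p : f1 (val p).1 = f2 (val p).2.
Proof. exact: (to_setP p). Qed.

Lemma fp_d_sub p : fp_set (gd (val p).1, gd (val p).2).
Proof. by rewrite /fp_set /= !ghomd fpP. Qed.

Lemma fp_r_sub p : fp_set (gr (val p).1, gr (val p).2).
Proof. by rewrite /fp_set /= !ghomr fpP. Qed.

Lemma fp_V_sub p : fp_set (ginv (val p).1, ginv (val p).2).
Proof. by rewrite /fp_set /= !ghomV fpP. Qed.

Definition fp_d p : fp_set := to_set (fp_d_sub p).
Definition fp_r p : fp_set := to_set (fp_r_sub p).
Definition fp_inv p : fp_set := to_set (fp_V_sub p).

(* the second case only occurs when [p] and [q] are not composable *)
Definition fp_mul p q : fp_set :=
  match pselect (fp_set (gmul (val p).1 (val q).1, gmul (val p).2 (val q).2)) with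
  | left h => to_set h
  | right _ => p
  end.

Lemma fp_composable p q : fp_d p = fp_r q <->
  gd (val p).1 = gr (val q).1 /\ gd (val p).2 = gr (val q).2.
Proof.
split=> [/(congr1 val)[]//|[e1 e2]]; apply: val_inj; by rewrite /= e1 e2.
Qed.

Lemma fp_mulE p q : fp_d p = fp_r q ->
  val (fp_mul p q) = (gmul (val p).1 (val q).1, gmul (val p).2 (val q).2).
Proof.
move=> /fp_composable[e1 e2]; rewrite /fp_mul; case: pselect => // -[].
by rewrite /fp_set /= !ghomM// !fpP.
Qed.

Lemma fp_val_eq p q : (val p).1 = (val q).1 -> (val p).2 = (val q).2 -> p = q.
Proof.
by move=> e1 e2; apply: val_inj; rewrite [LHS]surjective_pairing e1 e2 -surjective_pairing.
Qed.

Lemma nbhs_fp p (W : set fp_set) : nbhs p W <-> exists A1 A2,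
  [/\ nbhs (val p).1 A1, nbhs (val p).2 A2 &
    forall q, A1 (val q).1 -> A2 (val q).2 -> W q].
Proof.
split.
  move=> /nbhs_set_type[V [[A1 A2] /= [n1 n2] AV] VW]; exists A1, A2; split=> // q q1 q2.
  by apply: VW; apply: AV.
move=> [A1 [A2 [n1 n2 AW]]]; apply/nbhs_set_type; exists (A1 `*` A2).
  by exists (A1, A2).
by move=> q [q1 q2]; apply: AW.
Qed.

Lemma fp_mul_continuous : {within [set z : fp_set * fp_set | fp_d z.1 = fp_r z.2],
  continuous (fun z => fp_mul z.1 z.2)}.
Proof.
apply/subspace_continuousP => -[p q] /= e W; rewrite nbhs_simpl /=.
move=> /nbhs_fp[A1 [A2 []]]; rewrite fp_mulE//= => n1 n2 AW.
have [e1 e2] := (fp_composable p q).1 e.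
have [B1 [C1 [B1n C1n BC1]]] := gmul_nbhs e1 n1.
have [B2 [C2 [B2n C2n BC2]]] := gmul_nbhs e2 n2.
rewrite /fmap /= /within /=; exists
  ([set r : fp_set | B1 (val r).1 /\ B2 (val r).2],
   [set r : fp_set | C1 (val r).1 /\ C2 (val r).2]).
  by split; apply/nbhs_fp; [exists B1, B2|exists C1, C2].
move=> [a b] /= [[a1 a2] [b1 b2]] ab; apply: AW; rewrite fp_mulE//=.
  by apply: BC1 => //; move/fp_composable: ab => [].
by apply: BC2 => //; move/fp_composable: ab => [].
Qed.

Lemma fp_inv_continuous : continuous fp_inv.
Proof.
apply/continuous_nbhs => p W /nbhs_fp[A1 [A2 [/= n1 n2 AW]]]; apply/nbhs_fp.
exists (@ginv K1 @^-1` A1), (@ginv K2 @^-1` A2); split.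
- exact: ginv_continuous n1.
- exact: ginv_continuous n2.
- by move=> q q1 q2; apply: AW.
Qed.

Definition fp_groupoid : groupoid.
Proof.
apply: (@Groupoid fp_set fp_d fp_r fp_mul fp_inv).
- by move=> p; apply: fp_val_eq; rewrite /= gdd.
- by move=> p; apply: fp_val_eq; rewrite /= grd.
- by move=> p; apply: fp_val_eq; rewrite /= gdr.
- by move=> p; apply: fp_val_eq; rewrite /= grr.
- move=> p q e; have [e1 e2] := (fp_composable p q).1 e.
  by apply: fp_val_eq; rewrite /= fp_mulE//= gdM.
- move=> p q e; have [e1 e2] := (fp_composable p q).1 e.
  by apply: fp_val_eq; rewrite /= fp_mulE//= grM.
- move=> p q s e e'; have [e1 e2] := (fp_composable p q).1 e.
  have [e1' e2'] := (fp_composable q s).1 e'.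
  have h1 : fp_d p = fp_r (fp_mul q s).
    by apply/fp_composable; rewrite fp_mulE//= !grM.
  have h2 : fp_d (fp_mul p q) = fp_r s.
    by apply/fp_composable; rewrite fp_mulE//= !gdM.
  by apply: fp_val_eq; rewrite !fp_mulE//= gmulA.
- move=> p; have h : fp_d p = fp_r (fp_d p).
    by apply/fp_composable; rewrite /= !grd.
  by apply: fp_val_eq; rewrite fp_mulE//= gmulgd.
- move=> p; have h : fp_d (fp_r p) = fp_r p.
    by apply/fp_composable; rewrite /= !gdr.
  by apply: fp_val_eq; rewrite fp_mulE//= gmulrg.
- by move=> p; apply: fp_val_eq; rewrite /= gdV.
- by move=> p; apply: fp_val_eq; rewrite /= grV.
- move=> p; have h : fp_d p = fp_r (fp_inv p).
    by apply/fp_composable; rewrite /= !grV.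
  by apply: fp_val_eq; rewrite fp_mulE//= gmulgV.
- move=> p; have h : fp_d (fp_inv p) = fp_r p.
    by apply/fp_composable; rewrite /= !gdV.
  by apply: fp_val_eq; rewrite fp_mulE//= gmulVg.
- exact: fp_mul_continuous.
- exact: fp_inv_continuous.
Defined.

Lemma fp_gdE (p q : fp_groupoid) : gd p = q ->
  gd (val (p : fp_set)).1 = (val (q : fp_set)).1 /\
  gd (val (p : fp_set)).2 = (val (q : fp_set)).2.
Proof. by move=> <-. Qed.

Lemma fp_gd0_continuous : continuous (@gd0 fp_groupoid).
Proof.
apply: continuous_set_type; apply/continuous_nbhs => p W.
move=> /nbhs_fp[A1 [A2 [/= n1 n2 AW]]]; apply/nbhs_fp.
exists (@gd K1 @^-1` A1), (@gd K2 @^-1` A2); split.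
- exact: gd_continuous n1.
- exact: gd_continuous n2.
- by move=> q q1 q2; apply: AW.
Qed.

Lemma fp_gd0_open : open_map (@gd0 fp_groupoid).
Proof.
move=> A oA; apply/openP => _ [p Ap <-].
have /nbhs_fp[A1 [A2 [n1 n2 AW]]] : nbhs (p : fp_set) A by exact: open_nbhs_nbhs.
have [V [oV Vp inj]] := gd_inj (f1 (val p).1).
have m1 : nbhs (val p).1 (A1 `&` f1 @^-1` V).
  by apply: filterI => //; apply: f1_cont; exact: open_nbhs_nbhs.
have m2 : nbhs (val p).2 (A2 `&` f2 @^-1` V).
  by apply: filterI => //; apply: f2_cont; rewrite -fpP; exact: open_nbhs_nbhs.
have /nbhs_set_type[B1 b1 B1P] := open_map_nbhs (@gd0_open K1) m1.
have /nbhs_set_type[B2 b2 B2P] := open_map_nbhs (@gd0_open K2) m2.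
apply/nbhs_set_type; exists [set q : fp_set | B1 (val q).1 /\ B2 (val q).2].
  by apply/nbhs_fp; exists B1, B2.
move=> q [q1 q2]; have [u1 u2] := fp_gdE (to_setP q).
have [k1 [Ak1 Vk1] /(congr1 val)/= e1] := B1P (to_set (u1 : units K1 _)) q1.
have [k2 [Ak2 Vk2] /(congr1 val)/= e2] := B2P (to_set (u2 : units K2 _)) q2.
have k12 : fp_set (k1, k2).
  by apply: inj => //; rewrite /= -!ghomd e1 e2 fpP.
exists (to_set k12); first exact: AW.
by apply: val_inj; apply: fp_val_eq.
Qed.

Lemma fp_gd0_inj (p : fp_groupoid) : exists U, [/\ open U, U p &
  forall a b, U a -> U b -> gd0 a = gd0 b -> a = b].
Proof.
have [U1 [oU1 U1p inj1]] := gd_inj (val (p : fp_set)).1.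
have [U2 [oU2 U2p inj2]] := gd_inj (val (p : fp_set)).2.
exists [set q : fp_set | U1 (val q).1 /\ U2 (val q).2]; split=> //.
  apply/openP => q [q1 q2]; apply/nbhs_fp; exists U1, U2.
  by split=> //; exact: open_nbhs_nbhs.
move=> a b [a1 a2] [b1 b2] /(congr1 val)/fp_gdE[e1 e2].
by apply: fp_val_eq; [exact: inj1|exact: inj2].
Qed.

Definition fibre_product : etale_groupoid :=
  EtaleGroupoid (local_homeoI fp_gd0_continuous fp_gd0_open fp_gd0_inj).

Definition fp_fst : ghom fibre_product K1.
Proof.
exists (fun p : fp_set => (val p).1) => p q e.
by rewrite [gmul p q]/(fp_mul p q) fp_mulE//; move/fp_composable: e => [].
Defined.

Definition fp_snd : ghom fibre_product K2.
Proof.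
exists (fun p : fp_set => (val p).2) => p q e.
by rewrite [gmul p q]/(fp_mul p q) fp_mulE//; move/fp_composable: e => [].
Defined.

Lemma fp_fst_continuous : continuous fp_fst.
Proof.
apply/continuous_nbhs => p W Wn; apply/nbhs_fp; exists W, setT; split=> //.
exact: filterT.
Qed.

Lemma fp_snd_continuous : continuous fp_snd.
Proof.
apply/continuous_nbhs => p W Wn; apply/nbhs_fp; exists setT, W; split=> //.
exact: filterT.
Qed.

Section Pairing.
Variables (L : groupoid) (a1 : ghom L K1) (a2 : ghom L K2).
Hypothesis a12 : forall l, f1 (a1 l) = f2 (a2 l).

Definition fp_pair : ghom L fibre_product.
Proof.
exists (fun l => to_set (a12 l : fp_set (a1 l, a2 l))) => g h gh.
have [e1 e1'] := ghomP a1 gh; have [e2 e2'] := ghomP a2 gh.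
have e : fp_d (to_set (a12 g : fp_set (a1 g, a2 g))) =
         fp_r (to_set (a12 h : fp_set (a1 h, a2 h))) by apply/fp_composable.
by split=> //; apply: fp_val_eq; rewrite [in RHS]/= fp_mulE.
Defined.

Lemma fp_pair_continuous : continuous a1 -> continuous a2 -> continuous fp_pair.
Proof.
move=> /continuous_nbhs c1 /continuous_nbhs c2.
apply/continuous_nbhs => l W /nbhs_fp[A1 [A2 [/= n1 n2 AW]]].
apply: filterS (filterI (c1 l A1 n1) (c2 l A2 n2)) => m [m1 m2].
exact: AW.
Qed.

End Pairing.

Lemma fp_snd_inj : injective (ghom0 f1) -> injective (ghom0 fp_snd).
Proof.
move=> inj p q /(congr1 val)/= e2; apply: val_inj; apply: fp_val_eq => //.
have [p1 _] := fp_gdE (to_setP p); have [q1 _] := fp_gdE (to_setP q).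
apply: (congr1 val (_ : to_set (p1 : units K1 _) = to_set (q1 : units K1 _))).
by apply: inj; apply: val_inj; rewrite /= !fpP e2.
Qed.

Lemma fp_snd_open : open_map (ghom0 f1) -> open_map (ghom0 fp_snd).
Proof.
move=> of1 A oA; apply/openP => _ [p Ap <-].
have /nbhs_set_type[W /nbhs_fp[A1 [A2 [n1 n2 AW]]] WA] : nbhs p A.
  exact: open_nbhs_nbhs.
have [p1 p2] := fp_gdE (to_setP p).
pose u1 : units K1 := to_set (p1 : units K1 _).
have B1 : nbhs u1 [set u | A1 (val u)] by apply/nbhs_set_type; exists A1.
have B2 : nbhs (ghom0 fp_snd p)
    (ghom0 f2 @^-1` (ghom0 f1 @` [set u | A1 (val u)])).
  apply: (ghom0_continuous f2_cont).
  have <- : ghom0 f1 u1 = ghom0 f2 (ghom0 fp_snd p).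
    by apply: val_inj; rewrite /= fpP.
  exact: open_map_nbhs.
have C2 : nbhs (ghom0 fp_snd p) [set u | A2 (val u)] by apply/nbhs_set_type; exists A2.
apply: filterS (filterI B2 C2) => v [[u A1u /(congr1 val)/= uv] A2v].
have uvP : fp_set (val u, val v) by [].
have uvU : units fp_groupoid (to_set uvP).
  by apply: fp_val_eq; rewrite /=; [exact: (to_setP u)|exact: (to_setP v)].
exists (to_set uvU); first by apply: WA; apply: AW.
exact: val_inj.
Qed.

Lemma fp_fst_bij : fibrewise_bijective f2 -> fibrewise_bijective fp_fst.
Proof.
move=> bij; apply: fibrewise_bijectiveI.
  move=> p q /fp_gdE[_ e2] /= e; apply: fp_val_eq => //.
  by apply: (fibre_inj bij) => //; rewrite -!fpP e.
move=> u k1 /fp_gdE[_ u2] /= e.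
have [|k2 ek2 fk2] := fibre_surj bij u2 (h := f1 k1).
  by rewrite -fpP -ghomd e.
have k12 : fp_set (k1, k2) by [].
by exists (to_set k12) => //; apply: fp_val_eq.
Qed.

End FibreProduct.

Section FibreProductAssoc.
Variables (G2 G3 K1 K2 K3 : etale_groupoid).
Variables (f1 : ghom K1 G2) (f2 : ghom K2 G2) (g2 : ghom K2 G3) (g3 : ghom K3 G3).
Hypotheses (f1c : continuous f1) (f2c : continuous f2).
Hypotheses (g2c : continuous g2) (g3c : continuous g3).
Let M12 := fibre_product f1c f2c.
Let M23 := fibre_product g2c g3c.
Let h2 : ghom M12 G3 := ghom_comp g2 (fp_snd f1c f2c).
Let h1 : ghom M23 G2 := ghom_comp f2 (fp_fst g2c g3c).
Hypotheses (h2c : continuous h2) (h1c : continuous h1).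
Let K := fibre_product h2c g3c.
Let L := fibre_product f1c h1c.

Lemma fp_assoc : exists (i : ghom K L) (j : ghom L K),
  [/\ continuous i /\ continuous j, cancel i j, cancel j i,
    forall k, fp_fst f1c h1c (i k) = fp_fst f1c f2c (fp_fst h2c g3c k) &
    forall k, fp_snd g2c g3c (fp_snd f1c h1c (i k)) = fp_snd h2c g3c k].
Proof.
pose k1 : ghom K K1 := ghom_comp (fp_fst f1c f2c) (fp_fst h2c g3c).
pose k2 : ghom K K2 := ghom_comp (fp_snd f1c f2c) (fp_fst h2c g3c).
pose k3 : ghom K K3 := fp_snd h2c g3c.
pose l1 : ghom L K1 := fp_fst f1c h1c.
pose l2 : ghom L K2 := ghom_comp (fp_fst g2c g3c) (fp_snd f1c h1c).
pose l3 : ghom L K3 := ghom_comp (fp_snd g2c g3c) (fp_snd f1c h1c).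
have ck1 : continuous k1.
  by move=> k; apply: continuous_comp; exact: fp_fst_continuous.
have ck2 : continuous k2.
  move=> k; apply: continuous_comp; first exact: fp_fst_continuous.
  exact: fp_snd_continuous.
have ck3 : continuous k3 by exact: fp_snd_continuous.
have cl1 : continuous l1 by exact: fp_fst_continuous.
have cl2 : continuous l2.
  move=> k; apply: continuous_comp; first exact: fp_snd_continuous.
  exact: fp_fst_continuous.
have cl3 : continuous l3.
  by move=> k; apply: continuous_comp; exact: fp_snd_continuous.
have k12 k : f1 (k1 k) = f2 (k2 k) := fpP (fp_fst h2c g3c k).
have k23 k : g2 (k2 k) = g3 (k3 k) := @fpP _ _ _ h2 g3 k.
have l12 k : f1 (l1 k) = f2 (l2 k) := @fpP _ _ _ f1 h1 k.
have l23 k : g2 (l2 k) = g3 (l3 k) := fpP (fp_snd f1c h1c k).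
pose i2 : ghom K M23 := fp_pair g2c g3c k23.
pose j2 : ghom L M12 := fp_pair f1c f2c l12.
have hi k : f1 (k1 k) = h1 (i2 k) := k12 k.
have hj k : h2 (j2 k) = g3 (l3 k) := l23 k.
have ci2 : continuous i2 by exact: fp_pair_continuous.
have cj2 : continuous j2 by exact: fp_pair_continuous.
exists (fp_pair f1c h1c hi), (fp_pair h2c g3c hj); split=> //.
- by split; exact: fp_pair_continuous.
- by move=> k; apply: fp_val_eq => //=; exact: fp_val_eq.
- by move=> k; apply: fp_val_eq => //=; exact: fp_val_eq.
Qed.

End FibreProductAssoc.

Definition couple_id (G : etale_groupoid) : couple_morphism G G.
Proof.
apply: (@CoupleMorphism G G G (ghom_id G) (ghom_id G)).
- by move=> g; exact: cvg_id.
- by move=> g; exact: cvg_id.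
- by apply: fibrewise_bijectiveI => // u g uu gu; exists g; rewrite ?gu.
- move=> A oA; rewrite (_ : _ @` A = A)// predeqE => u; split.
    by move=> [v Av <-]; rewrite (_ : ghom0 _ v = v)//; exact: val_inj.
  by move=> Au; exists u => //; exact: val_inj.
- by move=> u v /(congr1 val)/= e; exact: val_inj.
Defined.

Definition couple_comp (G1 G2 G3 : etale_groupoid)
  (c2 : couple_morphism G2 G3) (c1 : couple_morphism G1 G2) :
  couple_morphism G1 G3.
Proof.
pose K := fibre_product (@cm_psi_continuous _ _ c1) (@cm_phi_continuous _ _ c2).
apply: (@CoupleMorphism G1 G3 K (ghom_comp (cm_phi c1) (fp_fst _ _))
  (ghom_comp (cm_psi c2) (fp_snd _ _))).
- move=> k; apply: continuous_comp; first exact: fp_fst_continuous.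
  exact: cm_phi_continuous.
- move=> k; apply: continuous_comp; first exact: fp_snd_continuous.
  exact: cm_psi_continuous.
- have b1 := @cm_phi_bij _ _ c1.
  have b2 : fibrewise_bijective (fp_fst (@cm_psi_continuous _ _ c1)
      (@cm_phi_continuous _ _ c2)) := fp_fst_bij (@cm_phi_bij _ _ c2).
  apply: fibrewise_bijectiveI.
    move=> g h e /= e'; apply: (fibre_inj b2) => //; apply: (fibre_inj b1) => //.
    by rewrite -!ghomd e.
  move=> u h uu hu; have [|k ku kh] := fibre_surj b1 _ hu.
    by rewrite -ghomd uu.
  by have [l lu lk] := fibre_surj b2 uu ku; exists l => //; rewrite -kh -lk.
- have -> : ghom0 (ghom_comp (cm_psi c2) (fp_snd (@cm_psi_continuous _ _ c1)
      (@cm_phi_continuous _ _ c2))) =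
      ghom0 (cm_psi c2) \o ghom0 (fp_snd _ _).
    by apply/funext => u; exact: val_inj.
  by apply: open_map_comp; [apply: fp_snd_open|]; exact: cm_psi_open.
- move=> u v /(congr1 val) e.
  apply: (@fp_snd_inj _ _ _ _ _ (@cm_psi_continuous _ _ c1)
    (@cm_phi_continuous _ _ c2) (@cm_psi_inj _ _ c1)).
  by apply: (@cm_psi_inj _ _ c2); exact: val_inj.
Defined.

Lemma couple_comp_eq G1 G2 G3 (c2 d2 : couple_morphism G2 G3)
    (c1 d1 : couple_morphism G1 G2) :
  couple_eq c2 d2 -> couple_eq c1 d1 ->
  couple_eq (couple_comp c2 c1) (couple_comp d2 d1).
Proof.
move=> [i2 [j2 [[ci2 cj2] ij2 ji2 ei2 ei2']]] [i1 [j1 [[ci1 cj1] ij1 ji1 ei1 ei1']]].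
have hi (k : cm_mid (couple_comp c2 c1)) :
    cm_psi d1 (ghom_comp i1 (fp_fst _ _) k) = cm_phi d2 (ghom_comp i2 (fp_snd _ _) k).
  by rewrite /= ei1' ei2; exact: fpP.
have hj (k : cm_mid (couple_comp d2 d1)) :
    cm_psi c1 (ghom_comp j1 (fp_fst _ _) k) = cm_phi c2 (ghom_comp j2 (fp_snd _ _) k).
  by rewrite /= -ei1' -ei2 ji1 ji2; exact: fpP.
exists (fp_pair _ _ hi), (fp_pair _ _ hj); split.
- split; apply: fp_pair_continuous => k; apply: continuous_comp.
  + exact: fp_fst_continuous.
  + exact: ci1.
  + exact: fp_snd_continuous.
  + exact: ci2.
  + exact: fp_fst_continuous.
  + exact: cj1.
  + exact: fp_snd_continuous.
  + exact: cj2.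
- by move=> k; apply: fp_val_eq => /=; rewrite ?ij1 ?ij2.
- by move=> k; apply: fp_val_eq => /=; rewrite ?ji1 ?ji2.
- by move=> k /=; rewrite ei1.
- by move=> k /=; rewrite ei2'.
Qed.

Lemma couple_comp1m G H (c : couple_morphism G H) :
  couple_eq (couple_comp (couple_id H) c) c.
Proof.
have h k : cm_psi c (ghom_id _ k) = cm_phi (couple_id H) (cm_psi c k) by [].
exists (fp_fst _ _), (fp_pair _ _ h); split=> //.
- split; first exact: fp_fst_continuous.
  apply: fp_pair_continuous; last exact: cm_psi_continuous.
  by move=> k; exact: cvg_id.
- by move=> k; apply: fp_val_eq => //=; exact: (@fpP _ _ _ (cm_psi c) (ghom_id H) k).
- by move=> k /=; exact: (@fpP _ _ _ (cm_psi c) (ghom_id H) k).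
Qed.

Lemma couple_compm1 G H (c : couple_morphism G H) :
  couple_eq (couple_comp c (couple_id G)) c.
Proof.
have h k : cm_psi (couple_id G) (cm_phi c k) = cm_phi c (ghom_id _ k) by [].
exists (fp_snd _ _), (fp_pair _ _ h); split=> //.
- split; first exact: fp_snd_continuous.
  apply: fp_pair_continuous; first exact: cm_phi_continuous.
  by move=> k; exact: cvg_id.
- by move=> k; apply: fp_val_eq => //=; symmetry; exact: (@fpP _ _ _ (ghom_id G) (cm_phi c) k).
- by move=> k /=; symmetry; exact: (@fpP _ _ _ (ghom_id G) (cm_phi c) k).
Qed.

Lemma couple_compA G1 G2 G3 G4 (c3 : couple_morphism G3 G4)
    (c2 : couple_morphism G2 G3) (c1 : couple_morphism G1 G2) :
  couple_eq (couple_comp c3 (couple_comp c2 c1))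
            (couple_comp (couple_comp c3 c2) c1).
Proof.
have [i [j [cij ij ji ei ej]]] := @fp_assoc _ _ _ _ _ _ _ _ _
  (@cm_psi_continuous _ _ c1) (@cm_phi_continuous _ _ c2)
  (@cm_psi_continuous _ _ c2) (@cm_phi_continuous _ _ c3)
  (@cm_psi_continuous _ _ (couple_comp c2 c1))
  (@cm_phi_continuous _ _ (couple_comp c3 c2)).
exists i, j; split; [exact: cij|exact: ij|exact: ji| |] => k.
- exact: (congr1 (cm_phi c1) (ei k)).
- exact: (congr1 (cm_psi c3) (ej k)).
Qed.

Record couple_class (G H : etale_groupoid) := CoupleClass {
  in_class :> couple_morphism G H -> Prop;
  in_classP : exists c, in_class = couple_eq c }.

Definition class_of (G H : etale_groupoid) (c : couple_morphism G H) :
  couple_class G H := CoupleClass (ex_intro _ c erefl).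

Definition class_repr (G H : etale_groupoid) (f : couple_class G H) :
  couple_morphism G H := projT1 (cid (in_classP f)).

Lemma class_ext G H (f g : couple_class G H) :
  (f : couple_morphism G H -> Prop) = g -> f = g.
Proof.
case: f g => F p [F' q] /= e; case: _ / e q => q.
by congr CoupleClass; exact: Prop_irrelevance.
Qed.

Lemma class_reprK G H (f : couple_class G H) : class_of (class_repr f) = f.
Proof.
by apply: class_ext; rewrite /class_repr; case: cid.
Qed.

Lemma class_ofP G H (c d : couple_morphism G H) :
  class_of c = class_of d <-> couple_eq c d.
Proof.
split=> [[->]|cd]; first exact: couple_eq_refl.
apply: class_ext; apply/funext => b; apply/propext; split.
  by apply: couple_eq_trans; exact: couple_eq_sym.
exact: couple_eq_trans.
Qed.

Lemma class_repr_of G H (c : couple_morphism G H) :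
  couple_eq (class_repr (class_of c)) c.
Proof. by apply/class_ofP; exact: class_reprK. Qed.

Definition class_comp (G1 G2 G3 : etale_groupoid)
    (f2 : couple_class G2 G3) (f1 : couple_class G1 G2) : couple_class G1 G3 :=
  class_of (couple_comp (class_repr f2) (class_repr f1)).

Lemma class_comp_of G1 G2 G3 (c2 : couple_morphism G2 G3)
    (c1 : couple_morphism G1 G2) :
  class_comp (class_of c2) (class_of c1) = class_of (couple_comp c2 c1).
Proof. by apply/class_ofP; apply: couple_comp_eq; exact: class_repr_of. Qed.

Definition EG : category.
Proof.
apply: (@Category etale_groupoid couple_class
  (fun G => class_of (couple_id G)) class_comp).
- move=> G1 G2 G3 G4 f3 f2 f1.
  rewrite -[f1]class_reprK -[f2]class_reprK -[f3]class_reprK !class_comp_of.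
  by apply/class_ofP; exact: couple_compA.
- move=> G H f; rewrite -[f]class_reprK class_comp_of.
  by apply/class_ofP; exact: couple_comp1m.
- move=> G H f; rewrite -[f]class_reprK class_comp_of.
  by apply/class_ofP; exact: couple_compm1.
Defined.

Definition proper_couple (G H : etale_groupoid) (c : couple_morphism G H) :=
  proper_map (ghom0 (cm_phi c)).

Lemma couple_comp_proper G1 G2 G3 (c2 : couple_morphism G2 G3)
    (c1 : couple_morphism G1 G2) :
  proper_couple c2 -> proper_couple c1 -> proper_couple (couple_comp c2 c1).
Proof.
move=> p2 p1 C /p1 cC.
pose psi_cont := ghom0_continuous (@cm_psi_continuous _ _ c1).
apply: (compact_of_image (f := ghom0 (fp_snd (@cm_psi_continuous _ _ c1)
  (@cm_phi_continuous _ _ c2)))).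
- by apply: fp_snd_inj; exact: cm_psi_inj.
- by apply: fp_snd_open; exact: cm_psi_open.
have := p2 _ (continuous_compact (continuous_subspaceT psi_cont) cC).
congr compact; rewrite predeqE => v; split.
  move=> [u Cu /(congr1 val)/= uv].
  have uvP : fp_set (cm_psi c1) (cm_phi c2) (val u, val v) by [].
  have uvU : units (cm_mid (couple_comp c2 c1)) (to_set uvP).
    by apply: fp_val_eq; rewrite /=; [exact: (to_setP u)|exact: (to_setP v)].
  exists (to_set uvU); last exact: val_inj.
  by rewrite /preimage /= (_ : ghom0 _ _ = ghom0 (cm_phi c1) u)//; exact: val_inj.
move=> [k Ck <-]; exists (ghom0 (fp_fst _ _) k).
  rewrite /preimage /= (_ : ghom0 _ _ = ghom0 (cm_phi (couple_comp c2 c1)) k)//.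
  exact: val_inj.
by apply: val_inj; rewrite /= fpP.
Qed.

(* a class is proper when it has a proper representative; all of its
   representatives are then proper *)
Definition EG_lcH : subcategory EG.
Proof.
apply: (@Subcategory EG (fun G => lcH (units G))
  (fun G H f => exists2 c, in_class f c & proper_couple c)).
- move=> G _; exists (couple_id G); first exact: couple_eq_refl.
  move=> C cC; rewrite (_ : _ @^-1` C = C)// predeqE => u /=.
  by rewrite (_ : ghom0 _ u = u)//; exact: val_inj.
- move=> G1 G2 G3 f2 f1 _ _ _ [c2 fc2 p2] [c1 fc1 p1].
  exists (couple_comp c2 c1); last exact: couple_comp_proper.
  move: fc1 fc2; rewrite -{1}[f1]class_reprK -{1}[f2]class_reprK => fc1 fc2.
  exact: couple_comp_eq.
Defined.

Lemma couple_action_id (G : etale_groupoid) :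
  couple_action (couple_id G) = am_id (slice_action G).
Proof.
apply: action_morphism_ext.
  apply/funext => U; apply: bis_ext; rewrite predeqE => g /=.
  by split=> [[k /= Uk <-]//|Ug]; exists g.
apply: pmap_ext => x y; rewrite couple_partialP; split=> [[u <- <-]|[<-]].
  by congr Some; exact: val_inj.
by exists x; exact: val_inj.
Qed.

Lemma couple_action_comp G1 G2 G3 (c2 : couple_morphism G2 G3)
    (c1 : couple_morphism G1 G2) :
  couple_action (couple_comp c2 c1) = am_comp (couple_action c2) (couple_action c1).
Proof.
apply: action_morphism_ext.
  apply/funext => U; apply: bis_ext; rewrite predeqE => h; split.
    move=> [k /= Uk <-]; exists (fp_snd _ _ k) => //=.
    by exists (fp_fst _ _ k) => //; exact: fpP.
  move=> [k2 /= [k1 /= Uk1 e] <-].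
  by exists (to_set (e : fp_set (cm_psi c1) (cm_phi c2) (k1, k2))).
apply: pmap_ext => z x; rewrite couple_partialP pcompP; split.
  move=> [k <- <-]; exists (ghom0 (cm_phi c2) (ghom0 (fp_snd _ _) k)).
    by apply/couple_partialP; eexists; [|reflexivity]; exact: val_inj.
  apply/couple_partialP; exists (ghom0 (fp_fst _ _) k); last exact: val_inj.
  by apply: val_inj => /=; exact: fpP.
move=> [y /couple_partialP[v <- <-] /couple_partialP[u /(congr1 val)/= uv <-]].
have uvP : fp_set (cm_psi c1) (cm_phi c2) (val u, val v) by [].
have uvU : units (cm_mid (couple_comp c2 c1)) (to_set uvP).
  by apply: fp_val_eq; rewrite /=; [exact: (to_setP u)|exact: (to_setP v)].
by exists (to_set uvU); exact: val_inj.
Qed.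

Definition SA : functor EG ISA.
Proof.
apply: (@Functor EG ISA slice_action
  (fun G H (f : couple_class G H) => couple_action (class_repr f))).
- move=> G; rewrite -[RHS]couple_action_id; apply: couple_action_eq.
  exact: class_repr_of.
- move=> G1 G2 G3 f2 f1; rewrite -[RHS]couple_action_comp; apply: couple_action_eq.
  exact: class_repr_of.
Defined.

(* [fmap SA] does not depend on the choice of representatives *)
Lemma SA_class_of (G H : etale_groupoid) (c : couple_morphism G H) :
  fmap SA (class_of c : @hom EG G H) = couple_action c.
Proof. by apply: couple_action_eq; exact: class_repr_of. Qed.

(* Main.v *)
From mathcomp Require Import all_boot all_classical topology.
Require Import Defs.

Set Implicit Arguments.
Unset Strict Implicit.
Unset Printing Implicit Defensive.

Local Open Scope classical_set_scope.

(** A functor descends to subcategories as soon as it carries distinguished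
    objects to distinguished objects and distinguished morphisms to
    distinguished morphisms, because inclusions of subcategories are faithful.
    For [SA] the objects are immediate, the space acted on by the slice action
    of [G] being the unit space of [G] itself. For a couple morphism
    [(phi, psi; K)] out of [G] and a compact set [C] of units, injectivity of
    [psi^(0)] gives
      [(phi^(0) o (psi^(0))^-1)^-1 (C) = psi^(0) ((phi^(0))^-1 (C))],
    the image under the continuous map [psi^(0)] of a set that is compact when
    [phi^(0)] is proper ([couple_action_proper]). *)

Section Descent.
Variables (C D : category) (S : subcategory C) (T : subcategory D).
Variable F : functor C D.
Hypothesis Fobj : forall X, sub_obj S X -> sub_obj T (F X).
Hypothesis Fhom : forall X Y (f : hom X Y), sub_obj S X -> sub_obj S Y ->
  sub_hom S f -> sub_hom T (fmap F f).

Definition functor_restrict : functor (subcat S) (subcat T).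
Proof.
apply: (@Functor (subcat S) (subcat T)
  (fun X => exist _ (F (proj1_sig X)) (Fobj (proj2_sig X)))
  (fun X Y f => exist _ (fmap F (proj1_sig f))
     (Fhom (proj2_sig X) (proj2_sig Y) (proj2_sig f)))).
- by move=> X; apply: sig_inj; exact: fmap1.
- by move=> X Y Z g f; apply: sig_inj; exact: fmapM.
Defined.

Lemma functor_restrict_inclusion :
  functor_comp (inclusion T) functor_restrict = functor_comp F (inclusion S).
Proof.
(* Both composites have convertible actions on objects and on morphisms, so
   they can only differ in the proofs of the functor laws. *)
by rewrite /functor_comp /=; congr Functor; exact: Prop_irrelevance.
Qed.

End Descent.

Section CouplePreimage.
Variables (G H : etale_groupoid) (c : couple_morphism G H).

Lemma ppreimage_couple_partial (C : set (units G)) :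
  ppreimage (couple_partial c) C =
  ghom0 (cm_psi c) @` (ghom0 (cm_phi c) @^-1` C).
Proof.
rewrite predeqE => y; split.
  by move=> [_ /couple_partialP[u <- <-] Cu]; exists u.
move=> [u Cu <-]; exists (ghom0 (cm_phi c) u) => //.
by apply/couple_partialP; exists u.
Qed.

Lemma couple_action_proper :
  proper_couple c -> proper_partial_map (am_xi (couple_action c)).
Proof.
move=> pc C /pc cC; rewrite [ppreimage _ _]ppreimage_couple_partial.
apply: continuous_compact cC; apply: continuous_subspaceT.
exact/ghom0_continuous/cm_psi_continuous.
Qed.

End CouplePreimage.

(** Properness of a class is witnessed by one of its representatives, and the
    action morphism can be computed from that representative. *)
Lemma SA_proper (G H : EG) (f : hom G H) :
  sub_hom EG_lcH f -> sub_hom ISA_lcH (fmap SA f).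
Proof.
rewrite -[f]class_reprK => -[c /class_ofP -> pc].
by rewrite SA_class_of; exact: couple_action_proper.
Qed.

Theorem corollary5p11 :
  exists F : functor (subcat EG_lcH) (subcat ISA_lcH),
    functor_comp (inclusion ISA_lcH) F = functor_comp SA (inclusion EG_lcH).
Proof.
have obj_lcH (G : EG) : sub_obj EG_lcH G -> sub_obj ISA_lcH (SA G) by [].
exists (functor_restrict obj_lcH (fun G H f _ _ => @SA_proper G H f)).
exact: functor_restrict_inclusion.
Qed.
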